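(* Let $m\ge 2$, $n\ge 1$ and let $\mathcal{A}\in T_{m,n}$ be an R$_0$-tensor that is semi-positive. Then $\mathcal{A}$ is an R-tensor, and hence $\mathcal{A}$ is a Q-tensor.
   Context: $T_{m,n}$ is the set of real $m$th order $n$-dimensional tensors $\mathcal{A}=(a_{i_1\cdots i_m})$, with real entries indexed by $i_1,\ldots,i_m\in I_n:=\{1,\ldots,n\}$ (no symmetry assumed). For $\mathbf{x}\in\mathbb{R}^n$, $\mathcal{A}\mathbf{x}^{m-1}\in\mathbb{R}^n$ is the vector with components $(\mathcal{A}\mathbf{x}^{m-1})_i=\sum_{i_2,\ldots,i_m=1}^n a_{ii_2\cdots i_m}x_{i_2}\cdots x_{i_m}$. Vector inequalities are componentwise. Tensor complementarity problem $(\mathbf{q},\mathcal{A})$, for $\mathbf{q}\in\mathbb{R}^n$: find $\mathbf{x}\in\mathbb{R}^n$ such that $\mathbf{x}\ge\mathbf{0}$, $\mathbf{q}+\mathcal{A}\mathbf{x}^{m-1}\ge\mathbf{0}$ and $\mathbf{x}^\top(\mathbf{q}+\mathcal{A}\mathbf{x}^{m-1})=0$. $\mathcal{A}$ is a Q-tensor iff $(\mathbf{q},\mathcal{A})$ has a solution for every $\mathbf{q}\in\mathbb{R}^n$. $\mathcal{A}$ is an R-tensor iff there are no $\mathbf{x}\in\mathbb{R}^n$ and $t\in\mathbb{R}$ with $\mathbf{0}\neq\mathbf{x}\ge\mathbf{0}$, $t\ge 0$, such that $(\mathcal{A}\mathbf{x}^{m-1})_i+t=0$ for every $i$ with $x_i>0$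 and $(\mathcal{A}\mathbf{x}^{m-1})_j+t\ge 0$ for every $j$ with $x_j=0$. $\mathcal{A}$ is an R$_0$-tensor iff this system has no solution $\mathbf{x}$ with $t=0$. $\mathcal{A}$ is semi-positive iff for each $\mathbf{x}\in\mathbb{R}^n$ with $\mathbf{x}\ge\mathbf{0}$, $\mathbf{x}\ne\mathbf{0}$, there is $k\in I_n$ with $x_k>0$ and $(\mathcal{A}\mathbf{x}^{m-1})_k\ge 0$. *)

(* Defs.v *)
(* Real tensors and tensor complementarity problems, in MathComp, over an
   arbitrary model R : realType of the real numbers; R^n is 'cV[R]_n. *)
From HB Require Import structures.
From mathcomp Require Import all_boot all_order all_algebra.
From mathcomp Require Import reals.
Set Implicit Arguments.
Unset Strict Implicit.
Unset Printing Implicit Defensive.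
Import Order.TTheory GRing.Theory Num.Theory.
Local Open Scope ring_scope.

(* The entry a_(i_1 ... i_m) of A is A [tuple i_1; ...; i_m]. *)
Definition tensor (R : realType) (m n : nat) := {ffun m.-tuple 'I_n -> R}.

Section TensorComplementarity.
Variables (R : realType) (m n : nat).
Implicit Types (A : tensor R m n) (x q : 'cV[R]_n) (t : R).

(* A x^(m-1). For m >= 1, the index tuples s = (i_1, ..., i_m) with
   ohead s = Some i are exactly those with i_1 = i, and behead s lists
   i_2, ..., i_m. *)
Definition tensor_apply A x : 'cV[R]_n :=
  \col_i \sum_(s : m.-tuple 'I_n | ohead s == Some i)
           A s * \prod_(j <- behead s) x j 0.

Definition nonneg x : Prop := forall i, 0 <= x i 0.

Definition TCP_solution q A x : Prop :=
  [/\ nonneg x,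
      nonneg (q + tensor_apply A x) &
      (x^T *m (q + tensor_apply A x)) 0 0 = 0].

Definition Q_tensor A : Prop :=
  forall q, exists x, TCP_solution q A x.

Definition R_system A x t : Prop :=
  [/\ x <> 0,
      nonneg x,
      forall i, 0 < x i 0 -> tensor_apply A x i 0 + t = 0 &
      forall j, x j 0 = 0 -> 0 <= tensor_apply A x j 0 + t].

Definition R_tensor A : Prop :=
  ~ exists x t, 0 <= t /\ R_system A x t.

Definition R0_tensor A : Prop :=
  ~ exists x, R_system A x 0.

Definition semi_positive A : Prop :=
  forall x, nonneg x -> x <> 0 ->
    exists k, 0 < x k 0 /\ 0 <= tensor_apply A x k 0.

End TensorComplementarity.

(* Main.v *)
(* An R0-tensor that is semi-positive is an R-tensor because a solution of the
   R-system with t > 0 would make every component of A x^(m-1) over the support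
   of x negative.  For the Q-property, homogenize: on the simplex of
   z = (z_0, x) in R^(n+1), look for z whose support consists of indices
   minimizing G_0 = 0, G_i = z_0^(m-1) q_i + (A x^(m-1))_i.  If z_0 > 0 then
   x / z_0 solves the complementarity problem; if z_0 = 0 then x and
   t = - min G solve the R-system, which is excluded.

   Such a z exists for every continuous G.  Scarf's combinatorial lemma,
   applied to a grid of mesh 1/N whose points are coloured by an index
   minimizing G, yields a small set of grid points such that every index i is
   either the colour of one of them or has i-th coordinate O(1/N) on all of
   them; let N tend to infinity. *)
Require Import Defs.
From HB Require Import structures.
From mathcomp Require Import all_boot all_order all_algebra.
From mathcomp Require Import reals.
From mathcomp Require Import zify.
Set Implicit Arguments.
Unset Strict Implicit.
Unset Printing Implicit Defensive.
Import Order.TTheory GRing.Theory Num.Theory.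

(** * Scarf's combinatorial lemma *)

(** Dropping one member of a colliding pair keeps the image, so [g] is injective on what is left and
    no second pair can collide. Applied to minimizer maps and to colourings, this yields the twos of
    the parity count. *)
Lemma imset_collision (A B : finType) (g : A -> B) (X : {set A}) :
    #|X| = #|g @: X|.+1 ->
  exists a b, [/\ a != b, g a = g b, a \in X, b \in X &
    forall x, (x \in X) && (g @: (X :\ x) == g @: X) = (x \in [set a; b])].
Proof.
move=> cX.
have /injectivePn : ~~ injectiveb (fun x : {x | x \in X} => g (val x)).
  apply/injectiveP => gI.
  have gIX : {in X &, injective g}.
    move=> x y xX yX gxy.
    exact: (congr1 val (gI (Sub x xX) (Sub y yX) gxy)).
  by move: cX; rewrite (card_in_imset gIX); lia.
move=> [[a aX] [[b bX] neq /= gab]].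
have {neq} ab : a != b by apply: contra neq => /eqP ab; apply/eqP/val_inj.
have dup x x' : x \in X -> x' \in X -> x != x' -> g x = g x' ->
    g @: (X :\ x) = g @: X.
  move=> xX x'X xx' gx; apply/setP => z; apply/imsetP/imsetP => -[t].
    by rewrite !inE => /andP[_ tX] ->; exists t.
  move=> tX ->; have [->|tx] := eqVneq t x.
    by exists x' => //; rewrite !inE eq_sym xx'.
  by exists t => //; rewrite !inE tx.
have gI : {in X :\ a &, injective g}.
  apply/imset_injP; rewrite (dup a b aX bX ab gab).
  by move: cX; rewrite (cardsD1 a X) aX; lia.
exists a, b; split=> // x; rewrite !inE.
apply/andP/orP => [[xX /eqP gX]|[]/eqP->]; last 2 first.
- by rewrite aX (dup a b).
- by rewrite bX (dup b a) // eq_sym.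
have : g x \in g @: (X :\ x) by rewrite gX imset_f.
move=> /imsetP[x']; rewrite !inE => /andP[x'x x'X] gx.
have [/eqP ?|xa] := boolP (x == a); [by left|right].
have [x'a|x'a] := eqVneq x' a.
  apply/eqP/gI; rewrite ?inE ?xa ?bX ?(eq_sym b) ?ab //.
  by rewrite gx x'a.
by move: x'x; rewrite (gI x x') ?inE ?xa ?x'a ?eqxx.
Qed.

Section Scarf.
Variables (V I : finType) (f : I -> V -> nat).
Hypothesis fI : forall i, injective (f i).

(** These are Scarf's primitive sets, up to the condition on the cardinality. *)
Definition dominating (S : {set V}) :=
  [forall y, [exists i, [forall x in S, f i y <= f i x]]].

Lemma dominatingP (S : {set V}) :
  reflect (forall y, exists i, forall x, x \in S -> f i y <= f i x)
          (dominating S).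
Proof.
apply: (iffP forallP) => domS y; last first.
  have [i iP] := domS y; apply/existsP; exists i.
  by apply/forallP => x; apply/implyP/iP.
by have /existsP[i /forallP iP] := domS y; exists i => x; apply/implyP/iP.
Qed.

Lemma dominatingS (S S' : {set V}) :
  S \subset S' -> dominating S' -> dominating S.
Proof.
move=> /subsetP sSS' /dominatingP dom; apply/dominatingP => y.
by have [i iP] := dom y; exists i => x /sSS'/iP.
Qed.

Definition is_minimizer (S : {set V}) (mu : I -> V) :=
  (forall i, mu i \in S) /\ forall i x, x \in S -> f i (mu i) <= f i x.

Lemma minimizer_exists (S : {set V}) : S != set0 ->
  exists mu, is_minimizer S mu.
Proof.
case/set0Pn => x0 x0S; exists (fun i => [arg min_(x < x0 in S) f i x]).
by split=> [i|i x xS]; case: arg_minnP => // z _; apply.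
Qed.

Lemma minimizer_dominating (S : {set V}) mu : is_minimizer S mu ->
  reflect (forall y, exists i, f i y <= f i (mu i)) (dominating S).
Proof.
move=> [muS mu_min]; apply: (iffP (dominatingP S)) => dom y.
  by have [i iP] := dom y; exists i; exact: iP.
by have [i iP] := dom y; exists i => x xS; exact: leq_trans iP (mu_min i x xS).
Qed.

(** Domination tested at a point of [S] itself makes that point the minimum in some order. Hence a
    dominating set has at most [#|I|] elements. *)
Lemma minimizer_imset (S : {set V}) mu : is_minimizer S mu -> dominating S ->
  mu @: setT = S.
Proof.
move=> muP /(minimizer_dominating muP) dom; have [muS mu_min] := muP.
apply/setP => x; apply/imsetP/idP => [[i _ ->] //|xS].
have [i le_x] := dom x; exists i => //; apply: (@fI i).
by apply/eqP; rewrite eqn_leq le_x mu_min.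
Qed.

Lemma minimizer_inj (S : {set V}) mu : is_minimizer S mu -> dominating S ->
  #|S| = #|I| -> injective mu.
Proof.
move=> muP domS cS.
have /imset_injP muI : #|mu @: setT| == #|[set: I]|.
  by rewrite (minimizer_imset muP domS) cS cardsT.
by move=> i j; apply: muI; rewrite inE.
Qed.

(** Order [c] can be released, since the minima in the other orders already exhaust [D]. Among the
    points above those minima, take the highest in order [c]; as [D] is dominating, it lies below
    [mu c] there and becomes the new minimum. *)
Lemma dominating_extension_exists (D : {set V}) mu c :
    is_minimizer D mu -> dominating D -> mu @: (setT :\ c) = D ->
    (exists y, forall i, i != c -> f i (mu i) < f i y) ->
  exists y, [/\ y \notin D, dominating (y |: D),
    forall i, i != c -> f i (mu i) < f i y,
    f c y < f c (mu c) &
    forall z, (forall i, i != c -> f i (mu i) < f i z) -> f c z <= f c y].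
Proof.
move=> muP domD muc [y0 y0P]; have [muD mu_min] := muP.
pose M := [pred y | [forall i, (i != c) ==> (f i (mu i) < f i y)]].
have MP z : reflect (forall i, i != c -> f i (mu i) < f i z) (M z).
  by apply: (iffP forallP) => zP i; apply/implyP/zP.
have [y /MP yM yc_max] := arg_maxnP (f c) (introT (MP y0) y0P).
have yD : y \notin D.
  apply/negP; rewrite -muc => /imsetP[i]; rewrite !inE andbT => ic yE.
  by have := yM i ic; rewrite yE ltnn.
have /(minimizer_dominating muP) dom := domD.
have yc : f c y < f c (mu c).
  have [i] := dom y; have [->|ic] := eqVneq i c.
    rewrite leq_eqVlt => /orP[/eqP/fI yE|//].
    by rewrite yE muD in yD.
  by rewrite leqNgt yM.
exists y; split=> //; last by move=> z /MP; exact: yc_max.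
apply/dominatingP => z; have [zM|/MP zM] := boolP (M z).
  exists c => x; rewrite !inE => /orP[/eqP->|xD]; first exact: yc_max.
  apply: leq_trans (yc_max z zM) _.
  exact: leq_trans (ltnW yc) (mu_min _ _ xD).
have [i ic zi] : exists2 i, i != c & f i z <= f i (mu i).
  case: (pickP [pred i | (i != c) && (f i z <= f i (mu i))]) => [i|none].
    by case/andP; exists i.
  case: zM => i ic; have := none i; rewrite /= ic /=.
  by rewrite ltnNge => ->.
exists i => x; rewrite !inE => /orP[/eqP->|xD].
  exact: leq_trans zi (ltnW (yM i ic)).
exact: leq_trans zi (mu_min _ _ xD).
Qed.

(** The pivoting step: [D] is one element short, so exactly two orders [a] and [b] share their
    minimum, and releasing either one gives an extension. Conversely, the minimizer map [nu] of an
    extension is injective, so the new point must undercut [mu] in order [a] or [b]. *)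
Lemma card_dominating_extensions (D : {set V}) mu :
    is_minimizer D mu -> dominating D -> #|I| = #|D|.+1 ->
    (forall c, exists y, forall i, i != c -> f i (mu i) < f i y) ->
  #|[set y | (y \notin D) && dominating (y |: D)]| = 2.
Proof.
move=> muP domD cI ext; have [muD mu_min] := muP.
have muT := minimizer_imset muP domD.
have [|a [b [ab mu_ab _ _ abP]]] := @imset_collision _ _ mu setT.
  by rewrite cardsT cI muT.
have drop c : c \in [set a; b] -> mu @: (setT :\ c) = D.
  by rewrite -abP muT inE => /eqP.
have aP := drop a (set21 a b); have bP := drop b (set22 a b).
have [ya [yaD doma ya_gt ya_lt ya_max]] :=
  dominating_extension_exists muP domD aP (ext a).
have [yb [ybD domb yb_gt yb_lt yb_max]] :=
  dominating_extension_exists muP domD bP (ext b).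
have yab : ya != yb.
  apply/eqP => E; have := ya_gt b; rewrite eq_sym ab => /(_ isT).
  by rewrite ltnNge E (ltnW yb_lt).
rewrite (_ : [set y | _] = [set ya; yb]) ?cards2 ?yab //.
apply/setP => y; rewrite !inE.
apply/andP/orP => [[yD domy]|[]/eqP-> //].
have [|nu nuP] := @minimizer_exists (y |: D).
  by apply/set0Pn; exists y; rewrite setU11.
have nuI : injective nu.
  by have := minimizer_inj nuP domy; rewrite cardsU1 yD cI; apply.
have [nuS nu_min] := nuP.
(* If [y] undercuts the old minimum in order [c], then [nu c = y]; injectivity of [nu] forbids this
   in a second order. *)
have ytest c i : f c y < f c (mu c) -> i != c -> f i (mu i) < f i y.
  move=> yc ic; rewrite ltnNge; apply/negP => yi.
  have nuE j : f j y <= f j (mu j) -> nu j = y.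
    move=> yj; have := nuS j; rewrite !inE => /orP[/eqP//|nuD].
    apply: (@fI j); apply/eqP; rewrite eqn_leq nu_min ?setU11 //=.
    exact: leq_trans yj (mu_min _ _ nuD).
  by case/eqP: ic; apply: nuI; rewrite !nuE // ltnW.
have finish c yc : f c y < f c (mu c) ->
    (forall i, i != c -> f i (mu i) < f i yc) ->
    (forall z, (forall i, i != c -> f i (mu i) < f i z) -> f c z <= f c yc) ->
    y == yc.
  move=> y_lt yc_gt yc_max; apply/eqP; apply: (@fI c); apply/eqP.
  rewrite eqn_leq yc_max /=; last by move=> i; exact: ytest.
  have /dominatingP/(_ yc)[i iP] := domy.
  have [<-|ic] := eqVneq i c; first by apply: iP; rewrite setU11.
  by have := yc_gt i ic; rewrite ltnNge iP // setU1r.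
have [ya_|ya_] := ltnP (f a y) (f a (mu a)); first by left; exact: (finish a).
right; apply: (finish b) => //; rewrite ltnNge; apply/negP => yb_.
have nuE j : f j (mu j) <= f j y -> nu j = mu j.
  move=> yj; apply: (@fI j); apply/eqP; rewrite eqn_leq nu_min ?setU1r //=.
  by have := nuS j; rewrite !inE => /orP[/eqP->//|/mu_min].
by case/eqP: ab; apply: nuI; rewrite !nuE.
Qed.

(* e i is the i-th slack: lowest for order i, above all ordinary points for the
   other orders. *)
Variables (e : I -> V) (c : V -> I) (v0 : V).
Hypothesis f_e_min : forall i v, f i (e i) <= f i v.
Hypothesis f_e_max : forall i j v,
  j != i -> v \notin codom e -> f i v < f i (e j).
Hypothesis eK : cancel e c.
Hypothesis v0_ord : v0 \notin codom e.

Lemma slack_lt i v : v != e i -> f i (e i) < f i v.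
Proof.
move=> vi; rewrite ltn_neqAle f_e_min andbT.
by apply: contra vi => /eqP/fI->.
Qed.

(** In each order [k != i0] the set contains the lowest point [e k], so an ordinary point can only
    be dominated in order [i0]. The added point must therefore be the ordinary point highest in that
    order. *)
Lemma card_boundary_extensions i0 (D := e @: [set~ i0]) :
  #|[set y | (y \notin D) && dominating (y |: D)]| = 1.
Proof.
have [y y_ord y_max] := arg_maxnP (f i0) (v0_ord : [predC codom e] v0).
have eD k : k != i0 -> e k \in D by move=> ki; rewrite imset_f // !inE.
apply/eqP/cards1P; exists y; apply/setP => z; rewrite !inE.
apply/andP/eqP => [[zD /dominatingP domz]|->]; last first.
  split.
    by apply: contra y_ord => /imsetP[k _ ->]; exact: codom_f.
  apply/dominatingP => v; have [/codomP[j ->]|v_ord] := boolP (v \in codom e).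
    by exists j => x _; exact: f_e_min.
  exists i0 => x; rewrite !inE => /orP[/eqP->|]; first exact: y_max.
  by case/imsetP => j; rewrite !inE => ji ->; apply/ltnW/f_e_max.
have dom v : v \notin codom e -> z != e i0 /\ f i0 v <= f i0 z.
  move=> v_ord; have [i iP] := domz v.
  have slackF : forall k, e k \in z |: D -> i <> k.
    move=> k kS ik; have := iP _ kS; rewrite leqNgt ik slack_lt //.
    by apply: contra v_ord => /eqP->; exact: codom_f.
  have ii0 : i = i0.
    apply/eqP; apply: contraT => ii0; case: (slackF i) => //.
    by rewrite setU1r ?eD.
  split; last by rewrite -ii0 iP ?setU11.
  apply/eqP => zE; case: (slackF i0) => //.
  by rewrite zE setU11.
have [z0 _] := dom v0 v0_ord; have [_ yz] := dom y y_ord.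
apply: (@fI i0); apply/eqP; rewrite eqn_leq yz andbT.
apply: y_max; apply/negP => /codomP[k zE]; rewrite zE in z0 zD.
have [ki|/eD kD] := eqVneq k i0; first by rewrite ki eqxx in z0.
by rewrite kD in zD.
Qed.

(** Slack [e a] lies above the minima in all orders but [a], unless the minimum in some order [i] is
    a slack other than [e i]. In that case [D] contains no ordinary point, and its colours make it
    the boundary set. *)
Lemma card_interior_extensions i0 (D : {set V}) :
    c @: D = [set~ i0] -> #|I| = #|D|.+1 -> D != e @: [set~ i0] ->
    dominating D ->
  #|[set y | (y \notin D) && dominating (y |: D)]| = 2.
Proof.
move=> cD cI Dn domD.
have D0 : D != set0.
  apply: contra Dn => /eqP DE.
  by rewrite DE imset0 in cD; rewrite DE -cD imset0.
have [mu muP] := minimizer_exists D0; have [muD mu_min] := muP.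
apply: (card_dominating_extensions muP) => // a; exists (e a) => i ia.
have [mu_e|mu_ord] := boolP (mu i \in codom e); last first.
  by apply: f_e_max => //; rewrite eq_sym.
case/codomP: mu_e => k mu_k; have [ki|ki] := eqVneq k i.
  rewrite mu_k ki slack_lt //.
  by apply: contra ia => /eqP/(can_inj eK)->.
case/eqP: Dn; rewrite -cD -imset_comp.
have De x : x \in D -> e (c x) = x.
  move=> xD; have [/codomP[j ->]|x_ord] := boolP (x \in codom e).
    by rewrite eK.
  by have := f_e_max ki x_ord; rewrite -mu_k ltnNge mu_min.
by rewrite -[LHS]imset_id; apply: eq_in_imset => x /De.
Qed.

(* Parity count of the pairs (x, S) with S dominating of size #|I| and S minus x
   carrying all colours but i0: grouped by S their number is even if no S carries
   all colours, grouped by S minus x it is odd, the only set with an odd number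
   of extensions being the boundary one. *)
Theorem scarf : exists S, dominating S /\ c @: S = setT.
Proof.
pose i0 := c v0; pose K := [set~ i0].
case: (pickP [pred S | dominating S && (c @: S == setT)]) => [S|none].
  by case/andP => domS /eqP cS; exists S.
exfalso.
have cK : #|K|.+1 = #|I| by rewrite (cardsC1 i0) prednK // (cardD1 i0).
pose P x (S : {set V}) :=
  [&& x \in S, #|S| == #|I|, dominating S & c @: (S :\ x) == K].
have even S : 2 %| #|[set x | P x S]|.
  have [->|] := eqVneq [set x | P x S] set0; first by rewrite cards0.
  case/set0Pn => x; rewrite inE => /and4P[xS /eqP cS domS /eqP cSx].
  have cSK : c @: S = K.
    apply/eqP; rewrite eqEsubset -{2}cSx imsetS ?subsetDl // andbT.
    apply/subsetP => i icS; rewrite !inE; apply/eqP => ii0.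
    have := none S; rewrite /= domS /= => /eqP; apply.
    apply/setP => j; rewrite inE; have [->|ji] := eqVneq j i0.
      by rewrite -ii0.
    have : j \in K by rewrite !inE.
    by rewrite -cSx; apply/subsetP/imsetS; exact: subsetDl.
  have [|a [b [ab _ _ _ abP]]] := @imset_collision _ _ c S.
    by rewrite cSK cK.
  rewrite (_ : [set x | P x S] = [set a; b]) ?cards2 ?ab //.
  by apply/setP => y; rewrite -abP inE /P cS eqxx domS cSK.
(* The same pairs, indexed by [D = S :\ x]. *)
pose Q x (D : {set V}) := (x \notin D) && P x (x |: D).
have QE (D : {set V}) : [set x | Q x D] =
    if (c @: D == K) && (#|I| == #|D|.+1)
    then [set x | (x \notin D) && dominating (x |: D)] else set0.
  apply/setP => x; rewrite inE /Q /P; have [xD|xD] := boolP (x \in D).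
    by case: ifP => _; rewrite !inE ?xD.
  rewrite setU1K // cardsU1 xD add1n setU11 /= (eq_sym _ #|I|).
  by case: (_ == K); case: (_ == _.+1); rewrite /= !inE ?xD ?andbT ?andbF.
have flip : \sum_(S : {set V}) #|[set x | P x S]| =
    \sum_(D : {set V}) #|[set x | Q x D]|.
  have swap (W : V -> {set V} -> bool) :
      \sum_S #|[set x | W x S]| = \sum_x \sum_(S | W x S) 1.
    rewrite (exchange_big_dep xpredT) //=; apply: eq_bigr => S _.
    by rewrite sum1dep_card.
  rewrite !swap; apply: eq_bigr => x _.
  rewrite (reindex_onto (fun D => x |: D) (fun S => S :\ x)) /=; last first.
    by move=> S /and4P[xS _ _ _]; exact: setD1K.
  apply: eq_bigl => D; rewrite /Q andbC; congr (_ && _).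
  apply/eqP/idP => [<-|]; last exact: setU1K.
  by rewrite !inE eqxx.
have /dvdnP[k1 Ek1] : 2 %| \sum_(S : {set V}) #|[set x | P x S]|.
  by apply: dvdn_sum => S _.
pose D0 := e @: K.
have cD0 : (c @: D0 == K) && (#|I| == #|D0|.+1).
  rewrite card_imset; last exact: can_inj eK.
  rewrite cK eqxx andbT -imset_comp -[eqbRHS]imset_id.
  by apply/eqP/eq_imset => i /=; rewrite eK.
have /dvdnP[k2 Ek2] : 2 %| \sum_(D | D != D0) #|[set x | Q x D]|.
  apply: dvdn_sum => D DD0; rewrite QE; case: ifP; last by rewrite cards0.
  case/andP => /eqP cD /eqP cI; have [domD|ndomD] := boolP (dominating D).
    by rewrite (card_interior_extensions cD cI).
  rewrite (_ : [set x | _] = set0) ?cards0 //; apply/setP => x; rewrite !inE.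
  apply/negP => /andP[_ domx]; case/negP: ndomD.
  by apply: dominatingS domx; exact: subsetUr.
move: flip; rewrite Ek1 (bigD1 D0) //= Ek2 QE cD0 card_boundary_extensions.
lia.
Qed.

End Scarf.

(** * Scarf's lemma on a grid of the simplex *)

Section Grid.
Variables (n N : nat).
Let grid := {x : {ffun 'I_n.+1 -> 'I_N.+1} | \sum_i x i == N}.

(* Coordinates with ties broken by enumeration; the extra points are the
   slacks. *)
Definition grid_rank (i : 'I_n.+1) (v : grid + 'I_n.+1) : nat :=
  match v with
  | inl x => (val x i * #|{: grid}| + enum_rank x).+1
  | inr j => if j == i then 0 else (N.+1 * #|{: grid}| + j).+1
  end.

Lemma grid_rank_bound (x : grid) i :
  val x i * #|{: grid}| + enum_rank x < N.+1 * #|{: grid}|.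
Proof.
apply: (@leq_trans ((val x i).+1 * #|{: grid}|)).
  by rewrite mulSnr ltn_add2l.
by rewrite leq_mul2r ltn_ord orbT.
Qed.

Lemma grid_rank_inj i : injective (grid_rank i).
Proof.
case=> [x|j] [y|k] /=.
- move=> [] /(congr1 (modn^~ #|{: grid}|)); rewrite !modnMDl !modn_small //.
  by move=> /val_inj/enum_rank_inj->.
- by case: ifP => // _ [] E; have := grid_rank_bound x i; rewrite E ltnNge leq_addr.
- by case: ifP => // _ [] E; have := grid_rank_bound y i; rewrite -E ltnNge leq_addr.
by case: eqP => [->|_]; case: eqP => [->|_] // [] /addnI/val_inj->.
Qed.

Lemma grid_rank_le i (x y : grid) :
  grid_rank i (inl y) <= grid_rank i (inl x) -> val y i <= val x i.
Proof.
rewrite /= ltnS => le_xy; rewrite -ltnS -(@ltn_pmul2r #|{: grid}|).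
  apply: leq_ltn_trans (leq_trans (leq_addr _ _) le_xy) _.
  by rewrite mulSnr ltn_add2l.
by apply/card_gt0P; exists x.
Qed.

Lemma grid_point (g : 'I_n.+1 -> nat) : \sum_i g i = N ->
  exists x : grid, forall i, val x i = g i :> nat.
Proof.
move=> gN; pose x := [ffun i => inord (g i)] : {ffun 'I_n.+1 -> 'I_N.+1}.
have xE i : x i = g i :> nat.
  by rewrite ffunE inordK // ltnS -gN (bigD1 i) //= leq_addr.
have xP : \sum_i x i == N by rewrite -[eqbRHS]gN; apply/eqP/eq_bigr.
by exists (Sub x xP).
Qed.

(** Let [b] be the coordinatewise minimum of the grid points in Scarf's set, replaced by 0 at
    indices whose slack is in the set. Domination forces the sum of [b] to be at least [N - n], so
    every grid point of the set exceeds [b] by at most [n] in each coordinate. *)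
Lemma grid_scarf (c : {ffun 'I_n.+1 -> 'I_N.+1} -> 'I_n.+1) :
  exists p : {ffun 'I_n.+1 -> 'I_N.+1}, \sum_i p i = N /\
  forall i, p i <= n \/ exists u : {ffun 'I_n.+1 -> 'I_N.+1},
    [/\ \sum_i u i = N, c u = i & forall j, p j <= u j + n /\ u j <= p j + n].
Proof.
have [|v0 _] := @grid_point (fun i => if i == ord0 then N else 0).
  by rewrite -big_mkcond big_pred1_eq.
pose col (v : grid + 'I_n.+1) := match v with inl x => c (val x) | inr j => j end.
have ordE (x : grid) : inl x \notin codom (@inr grid 'I_n.+1).
  by apply/codomP => -[].
have [||//||S [/dominatingP domS cS]] :=
  @scarf _ _ grid_rank grid_rank_inj inr col (inl v0).
- by move=> i v /=; rewrite eqxx.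
- move=> i j [x|k] ji; last by rewrite codom_f.
  move=> _ /=; rewrite (negbTE ji) ltnS.
  exact: leq_trans (grid_rank_bound x i) (leq_addr _ _).
- exact: ordE.
(* A slack in [S] has rank 0 in its own order, so grid points are dominated only in orders of [C];
   colours in [C] are carried by grid points. *)
pose C := [set i | inr i \notin S].
have domC (y : grid) : exists2 i, i \in C &
    forall x, inl x \in S -> val y i <= val x i.
  have [i iP] := domS (inl y); exists i; last first.
    by move=> x /iP/grid_rank_le.
  by rewrite inE; apply/negP => /iP /=; rewrite eqxx.
have colC i : i \in C -> exists2 x : grid, inl x \in S & c (val x) = i.
  move=> iC; have : i \in col @: S by rewrite cS inE.
  case/imsetP => -[x|j] xS iE; first by exists x.
  by rewrite inE iE xS in iC.
have [i1 i1C _] := domC v0; have [x0 x0S _] := colC i1 i1C.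
pose m i := val [arg min_(x < x0 | inl x \in S) nat_of_ord (val x i)] i.
have mP i : (exists2 x : grid, inl x \in S & m i = val x i) /\
    forall x : grid, inl x \in S -> m i <= val x i.
  by rewrite /m; case: arg_minnP => // x xS xmin; split=> //; exists x.
pose b i := if i \in C then nat_of_ord (m i) else 0.
have sum_b : N <= \sum_i b i + n.
  rewrite leqNgt; apply/negP => lt_bN.
  have sumC : \sum_(i in C) (m i).+1 <= N.
    apply: leq_trans lt_bN.
    under eq_bigr do rewrite -addn1.
    rewrite big_split /= sum1_card [in leqRHS]/b -big_mkcond /= -addnS leq_add2l.
    by rewrite -[leqRHS]card_ord max_card.
  (* This grid point exceeds [m] at every index of [C], with the excess mass put on [i1], so it is
     not dominated. *)
  have [|y yE] := @grid_point (fun i => (if i \in C then (m i).+1 else 0) +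
      (if i == i1 then N - \sum_(i in C) (m i).+1 else 0)).
    by rewrite big_split /= -!big_mkcond big_pred1_eq subnKC.
  have [i iC yi] := domC y; have [[x xS mE] _] := mP i.
  by have := yi x xS; rewrite yE iC -mE; lia.
have bound (x : grid) j : inl x \in S -> b j <= val x j /\ val x j <= b j + n.
  move=> xS; have bx i : b i <= val x i.
    by rewrite /b; case: ifP => // _; have [_ ->] := mP i.
  split=> //; move: sum_b; rewrite -{1}(eqP (valP x)).
  rewrite (bigD1 j) //= [X in _ <= X + _](bigD1 j) //= => le_xb.
  rewrite -(leq_add2r (\sum_(i | i != j) b i)) addnAC.
  by apply: leq_trans le_xb; rewrite leq_add2l; exact: leq_sum.
exists (val x0); split=> [|i]; first exact: (eqP (valP x0)).
have [iC|iC] := boolP (i \in C); last first.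
  by left; have [_] := bound x0 i x0S; rewrite /b (negbTE iC).
right; have [x xS cx] := colC i iC; exists (val x); split=> // [|j].
  exact: (eqP (valP x)).
have [] := bound x j xS; have [] := bound x0 j x0S; lia.
Qed.

End Grid.

(** * A complementarity theorem on the simplex *)

(* Imported only here because classical_sets shadows names of finset. *)
From mathcomp Require Import boolp classical_sets filter.
From mathcomp Require Import topology normedtype sequences realfun.
Import numFieldNormedType.Exports.
Local Open Scope ring_scope.
Local Open Scope classical_set_scope.

Lemma ultra_fmap (T S : Type) (f : T -> S) (F : set_system T) :
  UltraFilter F -> UltraFilter (f @ F).
Proof.
move=> FU; split=> [|G GF FG]; first exact: fmap_proper_filter.
rewrite eqEsubset; split=> // A GA.
have [//|/(FG (~` A)) GnA] := in_ultra_setVsetC (f @^-1` A) FU.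
by have [t []] := filter_ex (filterI GA GnA).
Qed.

Section SimplexComplementarity.
Variable R : realType.

Lemma cvg_col (T : Type) (F : set_system T) n (u : T -> 'cV[R]_n.+1)
    (l : 'cV[R]_n.+1) :
  Filter F -> (forall i, u k i 0 @[k --> F] --> l i 0) -> u @ F --> l.
Proof.
move=> FF cvg_u; apply/cvg_ballP => eps eps0.
have near_i : \forall k \near F, forall i, ball (l i 0) eps (u k i 0).
  apply: filter_forall => i.
  exact: (proj1 (cvg_ballP _ _) (cvg_u i)).
near=> k; split=> // i j; rewrite (ord1 j).
by move: i; near: k.
Unshelve. all: by end_near.
Qed.

Variable n : nat.
Implicit Types (x : 'cV[R]_n.+1) (G : 'I_n.+1 -> 'cV[R]_n.+1 -> R).

Lemma approximate_complementarity G k :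
  exists x, [/\ nonneg x, \sum_i x i 0 = 1 &
    forall i, x i 0 <= n%:R * harmonic k \/
      exists y : 'cV[R]_n.+1, (forall j, `|x j 0 - y j 0| <= n%:R * harmonic k) /\
                forall j, G i y <= G j y].
Proof.
(* [harmonic k] is 1/(k+1), so the grid has [N = k.+1]. *)
pose pt (p : {ffun 'I_n.+1 -> 'I_k.+2}) : 'cV[R]_n.+1 :=
  \col_i ((p i)%:R * harmonic k).
have h_ge0 : 0 <= harmonic k :> R by exact: harmonic_ge0.
have [p [p_sum pP]] :=
  grid_scarf (fun p => [arg min_(i < ord0) G i (pt p)]%O).
exists (pt p); split.
- by move=> i; rewrite mxE mulr_ge0.
- under eq_bigr do rewrite mxE.
  by rewrite -mulr_suml -natr_sum p_sum /harmonic /= divff // pnatr_eq0.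
move=> i; have [p_le|[u [_ ui up]]] := pP i; [left|right].
  by rewrite mxE ler_wpM2r // ler_nat.
exists (pt u); split=> [j|j]; last first.
  by move: ui; case: arg_minP => // i' _ i'P <-; exact: i'P.
rewrite !mxE -mulrBl normrM (ger0_norm h_ge0) ler_wpM2r //.
have [pu up'] := up j; rewrite ler_norml lerNl opprB !lerBlDl -!natrD !ler_nat.
by rewrite pu up'.
Qed.

(** Approximate solutions converge along an ultrafilter finer than [eventually], by compactness of
    [0, 1] in each coordinate. If the limit has positive i-th coordinate, the small-coordinate
    alternative fails on a set of the ultrafilter, and the inequality at the nearby points passes to
    the limit. *)
Lemma simplex_complementarity G : (forall i, continuous (G i)) ->
  exists x, [/\ nonneg x, \sum_i x i 0 = 1 &
    forall i j, 0 < x i 0 -> G i x <= G j x].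
Proof.
move=> Gcont; have [x xP] := choice (approximate_complementarity G).
have [U [UU sub_U]] := ultraFilterLemma eventually_filter.
have mesh0 : (n%:R * harmonic k : R) @[k --> U] --> (0 : R).
  rewrite -[X in _ --> X](mulr0 n%:R).
  by apply: cvgMr; apply: cvg_trans cvg_harmonic; exact: cvg_app.
have x01 k i : 0 <= x k i 0 <= 1.
  have [x_ge0 x_sum _] := xP k; rewrite x_ge0 -x_sum.
  by rewrite (bigD1 i) //= lerDl sumr_ge0.
have lim_x i : exists a : R, x k i 0 @[k --> U] --> a.
  have := @segment_compact R 0 1; rewrite compact_ultra.
  case/(_ (x k i 0 @[k --> U])) => [||a [_ ?]]; last by exists a.
    exact: ultra_fmap.
  by apply: nearW => k; rewrite /= in_itv /= x01.
have [a aP] := choice lim_x; pose l : 'cV[R]_n.+1 := \col_i a i.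
have x_l i : x k i 0 @[k --> U] --> l i 0 by rewrite mxE.
exists l; split.
- move=> i; apply: cvgr_to_ge (x_l i) _; apply: nearW => k.
  by have [] := xP k.
- have : \sum_i x k i 0 @[k --> U] --> \sum_i l i 0.
    by apply: cvg_big => [|i _]; [exact: add_continuous|exact: x_l].
  have -> : (fun k => \sum_i x k i 0) = (fun=> 1).
    by apply/funext => k; have [] := xP k.
  by move=> /cvg_unique; apply=> //; exact: cvg_cst.
move=> i j li_gt0.
have [Ui|Ui] := in_ultra_setVsetC [set k | x k i 0 <= n%:R * harmonic k] UU.
  have : l i 0 <= 0 by apply: ler_cvg_to (x_l i) mesh0 _.
  by rewrite leNgt li_gt0.
(* Where the i-th coordinate is small, [x k] itself serves as a dummy value, so that [y] is defined
   for all [k] and still converges to [l]. *)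
have near_y k : exists y : 'cV[R]_n.+1,
    (forall j, `|x k j 0 - y j 0| <= n%:R * harmonic k) /\
    (~ x k i 0 <= n%:R * harmonic k -> G i y <= G j y).
  have [_ _ /(_ i)[xi|[y [xy yG]]]] := xP k; last by exists y; split.
  by exists (x k); split=> // j'; rewrite subrr normr0 mulr_ge0 ?harmonic_ge0.
have [y yP] := choice near_y.
have y_l : y @ U --> l.
  apply: cvg_col => i'.
  have -> : (fun k => y k i' 0) = (fun k => x k i' 0 - (x k i' 0 - y k i' 0)).
    by apply/funext => k; rewrite subKr.
  rewrite -[X in _ --> X]subr0; apply: cvgB; first exact: x_l.
  apply/norm_cvg0P; apply: squeeze_cvgr (cvg_cst 0) mesh0.
  by apply: nearW => k; rewrite normr_ge0 /=; have [] := yP k.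
have G_l i' : G i' (y k) @[k --> U] --> G i' l.
  exact: cvg_comp y_l (Gcont i' l).
apply: ler_cvg_to (G_l i) (G_l j) _.
by apply: filterS Ui => k; have [_] := yP k.
Unshelve. all: by end_near.
Qed.

End SimplexComplementarity.

(** * Tensors *)

Section TensorComplementarity.
Variables (R : realType) (m n : nat).
Implicit Types (A : tensor R m n) (q x : 'cV[R]_n) (z : 'cV[R]_n.+1).

Lemma tensor_applyZ A a x :
  tensor_apply A (a *: x) = a ^+ m.-1 *: tensor_apply A x.
Proof.
apply/colP => i; rewrite !mxE mulr_sumr; apply: eq_bigr => s _.
under eq_bigr do rewrite mxE.
rewrite big_split /= big_const_seq count_predT iter_mulr_1 size_behead.
by rewrite size_tuple mulrCA.
Qed.

Lemma semi_positive_R0_R A : semi_positive A -> R0_tensor A -> R_tensor A.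
Proof.
move=> spA R0A [x [t [t_ge0 Axt]]]; have [x_neq0 x_ge0 Ax_eq _] := Axt.
have [k [xk Axk]] := spA x x_ge0 x_neq0.
have t0 : t = 0.
  apply/eqP; rewrite eq_le t_ge0 andbT -(Ax_eq k xk) lerDr //.
by case: R0A; exists x; rewrite -t0.
Qed.

Definition slack_tail z : 'cV[R]_n := \col_k z (lift ord0 k) 0.

(* Components of z_0^(m-1) q + A x^(m-1) for z = (z_0, x), preceded by a zero
   component for the slack z_0. *)
Definition homogenized A q (i : 'I_n.+1) z : R :=
  if unlift ord0 i is Some k
  then z ord0 0 ^+ m.-1 * q k 0 + tensor_apply A (slack_tail z) k 0 else 0.

Lemma homogenized_continuous A q i : continuous (homogenized A q i).
Proof.
rewrite /homogenized; case: unliftP => [k _|_]; last exact: cst_continuous.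
move=> z; have coord j : x j 0 @[x --> nbhs z] --> z j 0.
  exact: coord_continuous.
rewrite /continuous_at.
move: (nbhs z) (@nbhs_filter _ z) coord => F FF coord.
apply: cvgD.
  apply: cvgM; last exact: cvg_cst.
  exact: cvg_comp (coord ord0) (@exprn_continuous _ _ _).
have tail_cvg j : slack_tail x j 0 @[x --> F] --> slack_tail z j 0.
  by rewrite /slack_tail mxE; under eq_fun do rewrite mxE; exact: coord.
rewrite /tensor_apply mxE; under eq_fun do rewrite mxE.
apply: cvg_big => [|s _]; first exact: add_continuous.
apply: cvgM; first exact: cvg_cst.
by apply: cvg_big => [|j _]; [exact: mul_continuous|exact: tail_cvg].
Qed.

Lemma R_tensor_Q A : (2 <= m)%N -> R_tensor A -> Q_tensor A.
Proof.
move=> m_ge2 RA q.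
have [z [z_ge0 z_sum z_min]] :=
  simplex_complementarity (@homogenized_continuous A q).
have G0 : homogenized A q ord0 z = 0 by rewrite /homogenized unlift_none.
have GS k : homogenized A q (lift ord0 k) z =
    z ord0 0 ^+ m.-1 * q k 0 + tensor_apply A (slack_tail z) k 0.
  by rewrite /homogenized liftK.
have tailE k : slack_tail z k 0 = z (lift ord0 k) 0 by rewrite mxE.
have [z0|z0_neq0] := eqVneq (z ord0 0) 0.
  have {}GS k : homogenized A q (lift ord0 k) z =
      tensor_apply A (slack_tail z) k 0.
    (* Here [m >= 2] matters: the power of [z_0 = 0] must vanish. *)
    have /negbTE m1 : m.-1 != 0%N by lia.
    by rewrite GS z0 expr0n m1 mul0r add0r.
  have [i1 zi1] : exists i, 0 < z i 0.
    case: (pickP (fun i => 0 < z i 0)) => [i zi|none]; first by exists i.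
    have := oner_neq0 R; rewrite -z_sum big1 ?eqxx // => i _.
    by apply/eqP; rewrite eq_le z_ge0 leNgt none.
  (* The minimum of [G] is attained at [i1] and is at most [G_0 = 0], whence [t >= 0]. *)
  case: RA; exists (slack_tail z), (- homogenized A q i1 z); split.
    by rewrite oppr_ge0 -G0 z_min.
  split.
  - move=> tail0; have := oner_neq0 R; rewrite -z_sum big_ord_recl z0 add0r.
    by rewrite big1 ?eqxx // => k _; rewrite -tailE tail0 mxE.
  - by move=> k; rewrite tailE.
  - move=> k; rewrite tailE => zk; apply/eqP.
    by rewrite -GS subr_eq0 eq_le !z_min.
  - by move=> k _; rewrite -GS subr_ge0 z_min.
have z0_gt0 : 0 < z ord0 0 by rewrite lt0r z0_neq0 z_ge0.
have zm_gt0 : 0 < z ord0 0 ^+ m.-1 by rewrite exprn_gt0.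
pose x := (z ord0 0)^-1 *: slack_tail z.
have qAE k : (q + tensor_apply A x) k 0 =
    (z ord0 0 ^+ m.-1)^-1 * homogenized A q (lift ord0 k) z.
  rewrite GS mulrDr mulKf ?gt_eqF // /x tensor_applyZ exprVn.
  by rewrite mxE [X in _ + X]mxE.
(* Since [z_0 > 0], index 0 is minimizing and the minimum of [G] is 0. *)
have G_ge0 i : 0 <= homogenized A q i z by rewrite -G0 z_min.
exists x; split.
- by move=> k; rewrite mxE tailE mulr_ge0 // invr_ge0 ltW.
- by move=> k; rewrite qAE mulr_ge0 // invr_ge0 ltW.
rewrite mxE big1 // => k _; rewrite qAE !mxE.
have [zk|zk] := ltP 0 (z (lift ord0 k) 0).
  suff -> : homogenized A q (lift ord0 k) z = 0 by rewrite !mulr0.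
  by apply/eqP; rewrite eq_le G_ge0 -[leRHS]G0 z_min.
suff -> : z (lift ord0 k) 0 = 0 by rewrite mulr0 mul0r.
by apply/eqP; rewrite eq_le z_ge0 zk.
Qed.

End TensorComplementarity.

Theorem theorem3p4 (R : realType) (m n : nat) (hm : (2 <= m)%N)
  (hn : (1 <= n)%N) (A : tensor R m n)
  (hR0 : R0_tensor A) (hsp : semi_positive A) :
  R_tensor A /\ Q_tensor A.
Proof.
have RA := semi_positive_R0_R hsp hR0.
by split=> //; exact: R_tensor_Q.
Qed.
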